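(* For every point $x_0$ of a differentiable manifold $M$ and every linear connection $\nabla$ on $M$ there exist local bases of vector fields, defined in a neighborhood of $x_0$, in which the components of $\nabla$ vanish at $x_0$.
   Context: $\nabla$ is not assumed torsion free and the bases are not assumed to be coordinate ones. In a local basis (frame) $\{E_i\}$ of vector fields the components of $\nabla$ are the functions $\Gamma^i_{.jk}$ with $\nabla_X(E_j)=\Gamma^i_{.jk}X^kE_i$ for $X=X^kE_k$ (summation over repeated indices). *)

(* Defs.v *)
From HB Require Import structures.
From mathcomp Require Export all_boot all_order all_algebra.
From mathcomp Require Export all_classical all_reals all_analysis.

Set Implicit Arguments.
Unset Strict Implicit.
Unset Printing Implicit Defensive.

Export Order.TTheory GRing.Theory Num.Theory.
Export numFieldNormedType.Exports.

Local Open Scope classical_set_scope.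
Local Open Scope ring_scope.

(* [class_C k A f]: f is of class C^k on A.  It is only used for open sets A.
   A map is C^(k+1) when it is Frechet differentiable with a C^k differential;
   as the source will be finite dimensional, the differential is C^k iff all
   the directional derivatives 'D_v f are. *)
Fixpoint class_C (R : realType) (V W : normedModType R) (k : nat)
    (A : set V) (f : V -> W) {struct k} : Prop :=
  match k with
  | 0 => forall x, A x -> {for x, continuous f}
  | k'.+1 => (forall x, A x -> differentiable f x) /\
             (forall v, class_C k' A (fun x => 'D_v f x))
  end.

Definition smooth_on (R : realType) (V W : normedModType R)
    (A : set V) (f : V -> W) : Prop := forall k, class_C k A f.

(* Hausdorff smooth manifolds of dimension n, given by a smooth atlas indexed
   by [chart].  The chart i is the homeomorphism [coord i] from the open set
   [dom i] onto an open set of R^n, with inverse [coord_inv i]; the values of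
   these two functions outside [dom i] and its image are irrelevant.  Second
   countability is not required. *)
Record manifold (R : realType) (n : nat) := Manifold {
  carrier :> topologicalType;
  carrier_hausdorff : hausdorff_space carrier;
  chart : Type;
  dom : chart -> set carrier;
  coord : chart -> carrier -> 'rV[R]_n;
  coord_inv : chart -> 'rV[R]_n -> carrier;
  dom_open : forall i, open (dom i);
  dom_cover : forall x, exists i, dom i x;
  image_open : forall i, open (coord i @` dom i);
  coordK : forall i x, dom i x -> coord_inv i (coord i x) = x;
  coord_continuous :
    forall i x, dom i x -> {for x, continuous (coord i)};
  coord_inv_continuous :
    forall i y, (coord i @` dom i) y -> {for y, continuous (coord_inv i)};
  transition_smooth : forall i j,
    smooth_on (coord i @` (dom i `&` dom j)) (coord j \o coord_inv i)
}.

Arguments chart {R n} _.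
Arguments dom {R n} _ _.
Arguments coord {R n} _ _ _.
Arguments coord_inv {R n} _ _ _.

Definition chart_at (R : realType) (n : nat) (M : manifold R n) (x : M) :
    chart M := projT1 (cid (dom_cover x)).

Definition smooth_function (R : realType) (n : nat) (M : manifold R n)
    (f : M -> R) : Prop :=
  forall i, smooth_on (coord M i @` dom M i) (f \o coord_inv M i).

(* A tangent vector at x is the family (v i) of its components in the charts i
   around x, related by the Jacobians of the transition maps; by convention
   v i = 0 when x is not in the domain of the chart i, so that equal tangent
   vectors are equal families. *)
Definition tangent (R : realType) (n : nat) (M : manifold R n) (x : M) :
    set (chart M -> 'rV[R]_n) :=
  [set v | (forall i, ~ dom M i x -> v i = 0) /\
           (forall i j, dom M i x -> dom M j x ->
              v j = 'D_(v i) (coord M j \o coord_inv M i) (coord M i x))].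

(* Fields of families of components; only their values in [tangent] matter. *)
Definition field (R : realType) (n : nat) (M : manifold R n) : Type :=
  M -> chart M -> 'rV[R]_n.

(* X is a smooth vector field on the open set U; its values outside U are
   irrelevant. *)
Definition vector_field (R : realType) (n : nat) (M : manifold R n)
    (U : set M) (X : field M) : Prop :=
  (forall x, U x -> tangent x (X x)) /\
  (forall i, smooth_on (coord M i @` (U `&` dom M i))
                       (fun y => X (coord_inv M i y) i)).

(* The function X(f), computed at each point in some chart around it (the
   result does not depend on the chart when X is a vector field). *)
Definition lie (R : realType) (n : nat) (M : manifold R n)
    (X : field M) (f : M -> R) : M -> R :=
  fun x => let i := chart_at x in
           'D_(X x i) (f \o coord_inv M i) (coord M i x).

Definition fscale (R : realType) (n : nat) (M : manifold R n)
    (f : M -> R) (X : field M) : field M := fun x => f x *: X x.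

(* [nabla X Y] is the covariant derivative of Y along X; it only matters when X
   and Y are vector fields on the whole of M. *)
Record linear_connection (R : realType) (n : nat) (M : manifold R n)
    (nabla : field M -> field M -> field M) : Prop := LinearConnection {
  nabla_field : forall X Y,
    vector_field setT X -> vector_field setT Y ->
    vector_field setT (nabla X Y);
  nablaDl : forall X X' Y,
    vector_field setT X -> vector_field setT X' -> vector_field setT Y ->
    nabla (X \+ X') Y = nabla X Y \+ nabla X' Y;
  nablaZl : forall f X Y,
    smooth_function f -> vector_field setT X -> vector_field setT Y ->
    nabla (fscale f X) Y = fscale f (nabla X Y);
  nablaDr : forall X Y Y',
    vector_field setT X -> vector_field setT Y -> vector_field setT Y' ->
    nabla X (Y \+ Y') = nabla X Y \+ nabla X Y';
  nabla_leibniz : forall f X Y,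
    smooth_function f -> vector_field setT X -> vector_field setT Y ->
    nabla X (fscale f Y) = fscale (lie X f) Y \+ fscale f (nabla X Y)
}.

Definition extends_near (R : realType) (n : nat) (M : manifold R n)
    (x : M) (X X' : field M) : Prop :=
  vector_field setT X' /\ \forall y \near x, X' y = X y.

(* w is the value at x of the covariant derivative of Y along X, where X and Y
   are only defined around x: it is computed with global extensions of the
   germs of X and Y at x.  Both the existence of such extensions and the
   independence of the result from them are part of the definition. *)
Definition local_nabla (R : realType) (n : nat) (M : manifold R n)
    (nabla : field M -> field M -> field M) (X Y : field M) (x : M)
    (w : chart M -> 'rV[R]_n) : Prop :=
  (exists X' Y', extends_near x X X' /\ extends_near x Y Y') /\
  (forall X' Y', extends_near x X X' -> extends_near x Y Y' ->
     nabla X' Y' x = w).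

Definition local_frame (R : realType) (n : nat) (M : manifold R n)
    (U : set M) (E : 'I_n -> field M) : Prop :=
  (forall i, vector_field U (E i)) /\
  (forall x, U x ->
     (forall c : 'I_n -> R, \sum_i c i *: E i x = 0 -> forall i, c i = 0) /\
     (forall v, tangent x v ->
        exists c : 'I_n -> R, v = \sum_i c i *: E i x)).

(* Gamma i j k is the component with upper index i and lower indices j, k:
   nabla_X E_j = Gamma^i_jk X^k E_i on U for X = X^k E_k. *)
Definition connection_components (R : realType) (n : nat) (M : manifold R n)
    (nabla : field M -> field M -> field M) (U : set M)
    (E : 'I_n -> field M) (Gamma : 'I_n -> 'I_n -> 'I_n -> M -> R) : Prop :=
  forall (X : field M) (a : 'I_n -> M -> R),
    vector_field U X ->
    (forall x, U x -> X x = \sum_k a k x *: E k x) ->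
    forall (j : 'I_n) (x : M), U x ->
      local_nabla nabla X (E j) x
        (\sum_i \sum_k (Gamma i j k x * a k x) *: E i x).

(* Main.v *)
From HB Require Import structures.
Require Import Defs.
From mathcomp Require Import ring lra.

(** Let y be a chart around x0 with coordinate fields d_k, and let gamma^m_kj
be the components of nabla_(d_k) d_j at x0.  Put
  E_j = sum_m B_jm d_m  with  B_jm = delta_jm - sum_l gamma^m_lj (y^l - y0^l).
At x0 the matrix B is the identity, so E_k = d_k there, and the derivative
d_k B_jm is -gamma^m_kj.  As nabla_X Y at x0 depends on X only through its
value at x0, the Leibniz rule gives
  nabla_(E_k) E_j = sum_m (d_k B_jm) d_m + nabla_(d_k) d_j = 0  at x0.
Since B stays invertible near x0, the fields E_j form a frame there.  Their
brackets at x0 are the values of minus the torsion, so in general they are not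
the coordinate fields of a chart.

The connection only acts on fields defined on all of M, so every local object
has to be multiplied by a bump function.  A smooth bump on R^n is built from
exp(-1/t) ([smooth_bump_row]); it is transported to M by a chart, where the
Hausdorff property makes its support closed ([smooth_bump]).  Bump functions
also give the two locality properties of nabla, [nabla_pointwise] in the first
argument and [nabla_local] in the second one.  They make the components of
nabla in a frame well defined: see [frame_mx_components], where these
components are read off in a chart by inverting the matrix [frame_mx] of the
frame. *)

Set Implicit Arguments.
Unset Strict Implicit.
Unset Printing Implicit Defensive.

Local Open Scope classical_set_scope.
Local Open Scope ring_scope.

(** * Calculus of maps of class C^k *)

Lemma near_eq_differentiable (R : realType) (V W : normedModType R)
    (f g : V -> W) (x : V) :
  {near x, f =1 g} -> differentiable f x -> differentiable g x.
Proof.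
move=> fg df.
have gE : g \o shift x = cst (g x) + 'd f x +o_ 0 id.
  apply/eqaddoP => e e0.
  have /eqaddoP/(_ e e0) := diff_locally df.
  rewrite -(nbhs_singleton fg).
  have : \forall y \near 0, f (y + x) = g (y + x).
    by move: fg; rewrite [X in X -> _](near_shift 0 x) subr0.
  by apply: filterS2 => y /=; rewrite !fctE /= => ->.
have dfE : 'd g x = 'd f x :> (V -> W).
  by apply/diff_unique => //; exact: diff_continuous.
by apply/diff_locallyP; rewrite dfE; split => //; exact: diff_continuous.
Qed.

(** Being of class C^k at a point only involves the germ of the map there. *)
Lemma near_eq_class_C (R : realType) (V W : normedModType R) k (A : set V)
    (f g : V -> W) :
  (forall x, A x -> {near x, f =1 g}) -> class_C k A f -> class_C k A g.
Proof.
elim: k f g => [|k IH] f g fg /=.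
  move=> Cf x Ax; rewrite /prop_for /continuous_at -(nbhs_singleton (fg x Ax)).
  exact: cvg_trans (near_eq_cvg (fg x Ax)) (Cf x Ax).
move=> [df Cf]; split=> [x Ax|v].
  exact: near_eq_differentiable (fg x Ax) (df x Ax).
apply: IH (Cf v) => x Ax.
have /nbhs_interior := fg x Ax; apply: filterS => y fgy.
exact: near_eq_derive.
Qed.

Lemma eq_class_C (R : realType) (V W : normedModType R) k (A : set V)
    (f g : V -> W) : open A ->
  (forall x, A x -> f x = g x) -> class_C k A f -> class_C k A g.
Proof.
move=> Ao fg; apply: near_eq_class_C => x Ax.
exact: filterS fg (open_nbhs_nbhs (conj Ao Ax)).
Qed.

(** Smoothness of a map defined by patching can thus be checked around each
point separately. *)
Lemma class_C_pointwise (R : realType) (V W : normedModType R) k (A : set V)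
    (f : V -> W) : (forall x, A x -> class_C k [set x] f) -> class_C k A f.
Proof.
elim: k f => [|k IH] f /= fA; first by move=> x Ax; apply: (fA x Ax).
split=> [x Ax|v]; first by have [+ _] := fA x Ax; exact.
by apply: IH => x /fA[].
Qed.

Lemma sub_class_C (R : realType) (V W : normedModType R) k (A B : set V)
    (f : V -> W) : A `<=` B -> class_C k B f -> class_C k A f.
Proof.
move=> AB; elim: k f => [|k IH] f /=; first by move=> Cf x /AB; exact: Cf.
by move=> [df Cf]; split=> [x /AB|v]; [exact: df|exact/IH/Cf].
Qed.

Lemma class_C_pred (R : realType) (V W : normedModType R) k (A : set V)
    (f : V -> W) : class_C k.+1 A f -> class_C k A f.
Proof.
elim: k f => [|k IH] f; first
  by move=> [df _] x Ax; exact/differentiable_continuous/df.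
by move=> [df Cf]; split => // v; exact/IH/Cf.
Qed.

Lemma class_C_cst (R : realType) (V W : normedModType R) k (A : set V) (c : W) :
  class_C k A (cst c : V -> W).
Proof.
elim: k c => [|k IH] c /=; first by move=> x _; exact: cst_continuous.
split=> [x _|v]; first exact: differentiable_cst.
rewrite (_ : (fun _ => _) = cst 0) //; apply/funext => x; exact: derive_cst.
Qed.

Lemma class_CD (R : realType) (V W : normedModType R) k (A : set V)
    (f g : V -> W) : open A -> class_C k A f -> class_C k A g ->
  class_C k A (fun x => f x + g x).
Proof.
move=> Ao; elim: k f g => [|k IH] f g /=.
  by move=> Cf Cg x Ax; apply: continuousD; [exact: Cf|exact: Cg].
move=> [df Cf] [dg Cg]; split=> [x Ax|v].
  by apply: differentiableD; [exact: df|exact: dg].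
apply: eq_class_C (IH _ _ (Cf v) (Cg v)) => // x Ax.
by rewrite deriveD //; apply: diff_derivable; [exact: df|exact: dg].
Qed.

Lemma class_C_sum (R : realType) (V W : normedModType R) k (A : set V)
    n (f : 'I_n -> V -> W) : open A -> (forall i, class_C k A (f i)) ->
  class_C k A (fun x => \sum_i f i x).
Proof.
move=> Ao Cf; elim: n f Cf => [|n IH] f Cf.
  under eq_fun do rewrite big_ord0; exact: class_C_cst.
under eq_fun do rewrite big_ord_recl; exact/class_CD/IH.
Qed.

(** Scaling is a continuous bilinear map, so this is its differential composed
with that of the pair (f, g). *)
Lemma differentiable_scale (R : realType) (V W : normedModType R)
    (f : V -> R) (g : V -> W) x :
  differentiable f x -> differentiable g x ->
  differentiable (fun y => f y *: g y) x /\
  forall v, 'D_v (fun y => f y *: g y) x = 'D_v f x *: g x + f x *: 'D_v g x.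
Proof.
move=> df dg.
have bil : bilinear_for (GRing.Scale.Law.clone _ _ *:%R _)
    (GRing.Scale.Law.clone _ _ *:%R _) (@GRing.scale R W).
  split=> [u'|u] a y z /=; first by rewrite scalerDl scalerA.
  by rewrite scalerDr !scalerA mulrC.
pose bM := bilinear_isBilinear.Build R R W W _ _ _ bil.
pose b : {bilinear R -> W -> W} := HB.pack (@GRing.scale R W) bM.
have bc : continuous (fun p : R * W => b p.1 p.2).
  by move=> p; exact: scale_continuous.
have dp := differentiable_pair df dg.
have ds := differentiable_bilin (f x, g x) bc.
have dh : differentiable (fun y => f y *: g y) x.
  exact: (differentiable_comp dp ds).
split=> // v; rewrite deriveE //.
rewrite [LHS](_ : _ = ('d (fun p : R * W => b p.1 p.2) (f x, g x) \o
  'd (fun y => (f y, g y)) x) v); last by rewrite -(diff_comp dp ds).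
by rewrite (diff_bilin (f x, g x) bc) (diff_pair df dg) /= addrC !deriveE.
Qed.

Lemma class_C_scale (R : realType) (V W : normedModType R) k (A : set V)
    (f : V -> R) (g : V -> W) : open A -> class_C k A f -> class_C k A g ->
  class_C k A (fun x => f x *: g x).
Proof.
move=> Ao; elim: k f g => [|k IH] f g.
  by move=> Cf Cg x Ax; apply: continuousZ; [exact: Cf|exact: Cg].
move=> Cf Cg; have [[df Df] [dg Dg]] := (Cf, Cg); split=> [x Ax|v].
  by have [] := differentiable_scale (df x Ax) (dg x Ax).
have := class_CD Ao (IH _ _ (Df v) (class_C_pred Cg))
  (IH _ _ (class_C_pred Cf) (Dg v)).
apply: eq_class_C => // x Ax.
by have [_ ->] := differentiable_scale (df x Ax) (dg x Ax).
Qed.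

Lemma class_C_linear (R : realType) (V W : normedModType R) k (A : set V)
    (f : {linear V -> W}) : continuous f -> class_C k A f.
Proof.
move=> fc; case: k => [|k]; first by move=> x _; exact: fc.
split=> [x _|v]; first exact: linear_differentiable.
rewrite (_ : (fun _ => _) = cst (f v)); first exact: class_C_cst.
by apply/funext => x; rewrite deriveE ?diff_lin //; exact: linear_differentiable.
Qed.

Lemma derive_comp (R : realType) (V W Z : normedModType R)
    (f : W -> Z) (g : V -> W) x v :
  differentiable g x -> differentiable f (g x) ->
  'D_v (f \o g) x = 'D_('D_v g x) f (g x).
Proof.
move=> dg df; rewrite !deriveE //; last exact: differentiable_comp.
by rewrite (diff_comp dg df).
Qed.

Lemma coordinate_linear (R : realType) m (j : 'I_m) :
  {f : {linear 'rV[R]_m -> R} | continuous f & forall v, f v = v ord0 j}.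
Proof.
have fl : linear (fun v : 'rV[R]_m => v ord0 j : R).
  by move=> a u v; rewrite !mxE.
pose fM := GRing.isLinear.Build _ _ _ _ _ fl.
exists (HB.pack (fun v : 'rV[R]_m => v ord0 j : R) fM
  : {linear 'rV[R]_m -> R}) => //.
exact: matrix_normedtype.coord_continuous.
Qed.

Lemma derive_coordinate (R : realType) (V : normedModType R) m
    (g : V -> 'rV[R]_m) x v j : differentiable g x ->
  'D_v (fun y => g y ord0 j) x = 'D_v g x ord0 j.
Proof.
move=> dg; have [c cc cE] := coordinate_linear R j.
rewrite (_ : (fun y => _) = c \o g); last by apply/funext => y /=; rewrite cE.
have dc y : differentiable c y by exact: linear_differentiable.
by rewrite derive_comp // deriveE ?diff_lin // cE.
Qed.

Lemma class_C_coordinate (R : realType) (V : normedModType R) k (A : set V) m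
    (g : V -> 'rV[R]_m) j : open A -> class_C k A g ->
  class_C k A (fun y => g y ord0 j).
Proof.
have [c cc cE] := coordinate_linear R j.
move=> Ao; elim: k g => [|k IH] g.
  move=> Cg x Ax.
  rewrite (_ : (fun y => _) = c \o g); last by apply/funext => y /=; rewrite cE.
  by apply: continuous_comp; [exact: Cg|exact: cc].
move=> [dg Dg]; split=> [x Ax|v].
  rewrite (_ : (fun y => _) = c \o g); last by apply/funext => y /=; rewrite cE.
  by apply: differentiable_comp; [exact: dg|exact: linear_differentiable].
apply: eq_class_C (IH _ (Dg v)) => // x Ax.
by rewrite derive_coordinate //; exact: dg.
Qed.

(** A differential on R^m is determined by the partial derivatives; this keeps
the chain rule inside class C^k, where only directional derivatives are
available. *)
Lemma derive_row (R : realType) (W : normedModType R) m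
    (f : 'rV[R]_m -> W) y v : differentiable f y ->
  'D_v f y = \sum_j v ord0 j *: 'D_(delta_mx ord0 j) f y.
Proof.
move=> df; rewrite deriveE // {1}(row_sum_delta v) linear_sum.
by apply: eq_bigr => j _; rewrite linearZ deriveE.
Qed.

(** By induction on k: the derivative of f o g is the sum over j of the j-th
coordinate of that of g times the j-th partial derivative of f, composed with
g. *)
Lemma class_C_comp (R : realType) (V W : normedModType R) k m
    (A : set V) (B : set 'rV[R]_m) (f : 'rV[R]_m -> W) (g : V -> 'rV[R]_m) :
  open A -> (forall x, A x -> B (g x)) ->
  class_C k B f -> class_C k A g -> class_C k A (f \o g).
Proof.
move=> Ao gAB; elim: k f => [|k IH] f.
  by move=> Cf Cg x Ax; apply: continuous_comp; [exact: Cg|exact/Cf/gAB].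
move=> [df Df] Cg; have [dg Dg] := Cg; split=> [x Ax|v].
  by apply: differentiable_comp; [exact: dg|exact/df/gAB].
have : class_C k A (fun x => \sum_j ('D_v g x) ord0 j *:
    ('D_(delta_mx ord0 j) f \o g) x).
  apply: class_C_sum => // j; apply: class_C_scale => //.
    exact: class_C_coordinate Ao (Dg v).
  by apply: IH (class_C_pred Cg); exact: Df.
apply: eq_class_C => // x Ax.
rewrite [RHS]derive_comp; [|exact: dg|exact/df/gAB].
by rewrite -derive_row //; exact/df/gAB.
Qed.

Lemma derive_affine (R : realType) (V W : normedModType R) (f : V -> W)
    (a v : V) (w : W) :
  (forall h : R, f (h *: v + a) = f a + h *: w) -> 'D_v f a = w.
Proof.
move=> fE; apply: lim_near_cst => //; near=> h.
have h0 : h != 0 by near: h; exact: nbhs_dnbhs_neq.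
by rewrite /= fE addrC addKr scalerA mulVf // scale1r.
Unshelve. all: by end_near. Qed.

(** * A smooth bump function on R^n *)

(** The functions t^-m exp(-1/t), extended by 0 to t <= 0, form a family whose
linear span is closed under differentiation; m = 0 is the classical flat
function. *)
Definition flat (R : realType) (m : nat) (t : R) : R :=
  if 0 < t then t ^- m * expR (- t^-1) else 0.

Lemma flat_ge0 (R : realType) m (t : R) : 0 <= flat m t.
Proof.
rewrite /flat; case: ifPn => // t0.
by rewrite mulr_ge0 ?expR_ge0 // invr_ge0 exprn_ge0 // ltW.
Qed.

(** The exponential series gives exp(1/t) >= t^-(m+2) / (m+2)!.  The exponent
2 makes the derivative at 0 exist and vanish. *)
Lemma flat_le_sqr (R : realType) m (t : R) : flat m t <= (m.+2)`!%:R * t ^+ 2.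
Proof.
rewrite /flat; case: ifPn => t0; last by rewrite mulr_ge0 ?ler0n ?sqr_ge0.
have f0 : 0 < (m.+2)`!%:R :> R by rewrite ltr0n fact_gt0.
have e0 := expR_gt0 t^-1.
have : t^-1 ^+ m.+2 / (m.+2)`!%:R <= expR t^-1.
  apply: le_trans (expR_ge1Dxn m.+1 _); last by rewrite invr_ge0 ltW.
  by rewrite lerDr.
rewrite ler_pdivrMr // mulrC -ler_pdivrMr // => le_fact.
have -> : t ^- m * expR (- t^-1) = t^-1 ^+ m.+2 / expR t^-1 * t ^+ 2.
  by rewrite expRN -exprVn !exprS; field; rewrite !gt_eqF.
by rewrite ler_pM2r // exprn_gt0.
Qed.

(** At 0 the bound by t^2 makes the difference quotients tend to 0; elsewhere
this is the usual differentiation rule. *)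
Lemma is_derive_flat (R : realType) m (x : R) :
  is_derive x (1 : R) (flat m) (flat m.+2 x - m%:R * flat m.+1 x).
Proof.
case: (ltgtP x 0) => [x0|x0|->].
- have flat0 n : {near x, cst 0 =1 flat n}.
    by near=> y; rewrite /flat ltNge ifN // negbK; near: y; exact: lt_le_nbhsl.
  rewrite -!(nbhs_singleton (flat0 _)) mulr0 subr0.
  exact: near_eq_is_derive (flat0 m) _.
- have xn0 : x != 0 by rewrite gt_eqF.
  have formula : {near x, (fun t : R => t^-1 ^+ m * expR (- t^-1)) =1 flat m}.
    by near=> y; rewrite /flat exprVn ifT //; near: y; exact: lt_nbhsr.
  apply: near_eq_is_derive formula _.
  have dV : is_derive x (1 : R) (fun y : R => y^-1) (- x ^- 2 *: 1).
    exact: is_deriveV.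
  have dX := @is_deriveX R R (fun y : R => y^-1) m x 1 _ dV.
  have dN : is_derive x (1 : R) (fun y : R => - y^-1) (- (- x ^- 2 *: 1)).
    exact: is_deriveN.
  have dE := @is_derive1_comp R expR (fun y => - y^-1) x _ _
    (is_derive_expR _) dN.
  have dP := @is_deriveM R R _ _ _ _ _ _ dX dE.
  rewrite (_ : (fun t => _) =
    (@GRing.inv R : R -> R) ^+ m * (expR \o (fun y => - y^-1))); last first.
    by apply/funext => y; rewrite !fctE.
  apply: is_derive_eq dP _.
  rewrite /flat x0 !fctE /= /GRing.scale /= -!exprVn !mulr1.
  case: m {dX} => [|m]; first by rewrite !mul0r !mulr0 subr0 !exprS /=; ring.
  by rewrite /= !exprS; ring.
- have flat0 n : flat n (0 : R) = 0 by rewrite /flat ltxx.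
  rewrite !flat0 mulr0 subr0.
  have lim0 : h^-1 *: ((flat m \o shift 0) (h *: (1 : R)) - flat m 0)
      @[h --> 0^'] --> (0 : R).
    have f0 : 0 < (m.+2)`!%:R :> R by rewrite ltr0n fact_gt0.
    apply/cvgrPdist_le => e e0; near=> h.
    rewrite flat0 subr0 /= addr0 sub0r normrN normrM normfV [h *: 1]mulr1.
    have h0 : 0 < `|h| by rewrite normr_gt0; near: h; exact: nbhs_dnbhs_neq.
    rewrite ler_pdivrMl // ger0_norm ?flat_ge0 //.
    apply: le_trans (flat_le_sqr _ _) _.
    rewrite -real_normK ?num_real // expr2 mulrCA ler_pM2l //.
    rewrite -ler_pdivlMl // mulrC.
    near: h; apply: dnbhs0_le; exact: divr_gt0.
  by apply: DeriveDef; [apply/cvg_ex; exists 0; exact: lim0|exact: cvg_lim lim0].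
Unshelve. all: by end_near. Qed.

(** The derivative of flat m o g only involves derivatives of g and other
members of the family composed with g, so the induction on k goes through for
all m at once. *)
Lemma class_C_flat (R : realType) (V : normedModType R) k (A : set V) m
    (g : V -> R) :
  open A -> class_C k A g -> class_C k A (fun x => flat m (g x)).
Proof.
have df j (y : R) : differentiable (flat j) y.
  apply/derivable1_diffP; have [] := is_derive_flat j y; exact.
move=> Ao; elim: k m g => [|k IH] m g.
  move=> Cg x Ax; apply: (@continuous_comp _ _ _ g (flat m)); first exact: Cg.
  exact: differentiable_continuous.
move=> Cg; have [dg Dg] := Cg; split=> [x Ax|v].
  by apply: (@differentiable_comp _ _ _ _ g (flat m)); first exact: dg.
have Cm j : class_C k A (fun x => flat j (g x)) by exact/IH/class_C_pred.
have := class_C_scale Ao (Dg v) (class_CD Ao (Cm m.+2)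
  (class_C_scale Ao (class_C_cst k A (- m%:R : R)) (Cm m.+1))).
apply: eq_class_C => // x Ax.
rewrite -[RHS]/('D_v (flat m \o g) x) [RHS]derive_comp //; last exact: dg.
rewrite [RHS]deriveE // diff1E // derive1E.
by have [_ ->] := is_derive_flat m (g x); rewrite scaleNr.
Qed.

Lemma flat_ge_flat1 (R : realType) (t : R) : 1 <= t -> flat 0 1 <= flat 0 t.
Proof.
move=> t1; have t0 : 0 < t by exact: lt_le_trans t1.
by rewrite /flat t0 ltr01 !expr0 invr1 !mul1r ler_expR lerN2 invf_le1.
Qed.

(** With h the flat function, h(c - h(s)) / h(c) for c = h(1) is 1 when s <= 0
and 0 when s >= 1; s is an affine function of the squared Euclidean distance
to y0.  Composing with h replaces the usual quotient of smooth functions. *)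
Lemma smooth_bump_row (R : realType) n (y0 : 'rV[R]_n) (r : R) : 0 < r ->
  exists b : 'rV[R]_n -> R, [/\ forall k, class_C k setT b,
    \forall y \near y0, b y = 1 & forall y, r < `|y - y0| -> b y = 0].
Proof.
move=> r0; have r2 : 0 < r ^+ 2 by exact: exprn_gt0.
pose q (y : 'rV[R]_n) := \sum_j (y - y0) ord0 j *: ((y - y0) ord0 j : R).
(* s <= 0 exactly when q <= r^2 / 2, and s >= 1 exactly when q >= r^2; the sup
   norm is at most the Euclidean one, so s >= 1 when it exceeds r. *)
pose s y := (2 / r ^+ 2) *: q y + (-1).
pose c : R := flat 0 1.
have c0 : 0 < c by rewrite /c /flat ltr01 expr0 invr1 mul1r expR_gt0.
have Cq k : class_C k setT q.
  have Cj j : class_C k setT (fun y : 'rV[R]_n => (y - y0) ord0 j : R).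
    apply: class_C_coordinate; first exact: openT.
    apply: class_CD; first exact: openT.
      by apply: (@class_C_linear _ _ _ _ _ idfun) => x; exact: cvg_id.
    exact: class_C_cst.
  apply: class_C_sum => [|j]; first exact: openT.
  by apply: class_C_scale; [exact: openT|exact: Cj|exact: Cj].
have Cs k : class_C k setT s.
  apply: class_CD; [exact: openT| |exact: class_C_cst].
  by apply: class_C_scale; [exact: openT|exact: class_C_cst|exact: Cq].
have flat0 (t : R) : t <= 0 -> flat 0 t = 0.
  by move=> t0; rewrite /flat ltNge t0.
exists (fun y => (flat 0 c)^-1 *: flat 0 (c + (- 1) *: flat 0 (s y))); split.
- move=> k; apply: class_C_scale; [exact: openT|exact: class_C_cst|].
  apply: class_C_flat; first exact: openT.
  apply: class_CD; [exact: openT|exact: class_C_cst|].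
  apply: class_C_scale; [exact: openT|exact: class_C_cst|].
  by apply: class_C_flat; [exact: openT|exact: Cs].
- have qy0 : q y0 = 0 by rewrite /q subrr big1 // => j _; rewrite mxE scale0r.
  have : \forall y \near y0, q y < r ^+ 2 / 2.
    have := Cq 0%N y0 I; rewrite /prop_for /continuous_at qy0.
    by move=> /cvgr_lt; apply; exact: divr_gt0.
  apply: filterS => y qy.
  rewrite (flat0 (s y)); last first.
    rewrite /s subr_le0 /GRing.scale /= mulrAC ler_pdivrMr // mul1r.
    by rewrite mulrC -ler_pdivlMr // ltW.
  rewrite scaler0 addr0 /GRing.scale /= mulVf //.
  by rewrite /flat c0 expr0 invr1 mul1r gt_eqF // expR_gt0.
- move=> y ry; rewrite (flat0 (_ + _)) ?scaler0 //.
  rewrite scaleN1r subr_le0 flat_ge_flat1 // /s lerBrDr.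
  have [j rj] : exists j, r < `|(y - y0) ord0 j|.
    apply: contrapT => /forallNP yr; move: ry; rewrite ltNge => /negP; apply.
    rewrite [leLHS]/Num.norm /= mx_normrE; apply: bigmax_le; first exact: ltW.
    by move=> [i j] _; rewrite (ord1 i) leNgt; exact/negP/yr.
  suff rq : r ^+ 2 <= q y.
    by rewrite /GRing.scale /= mulrAC ler_pdivlMr // ler_pM2l.
  rewrite /q (bigD1 j) //= -[r ^+ 2]addr0 lerD //.
    rewrite /GRing.scale /= -expr2 -[X in _ <= X]real_normK ?num_real //.
    by rewrite ler_pXn2r // ?nnegrE ?ltW.
  by apply: sumr_ge0 => i _; rewrite /GRing.scale /= -expr2 sqr_ge0.
Qed.

(** * Smooth functions on a manifold *)

Definition smooth_function_on (R : realType) (n : nat) (M : manifold R n)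
    (U : set M) (f : M -> R) : Prop :=
  forall i, smooth_on (coord M i @` (U `&` dom M i)) (f \o coord_inv M i).

Lemma smooth_function_onT (R : realType) (n : nat) (M : manifold R n)
    (f : M -> R) : smooth_function_on setT f <-> smooth_function f.
Proof. by split=> fs i; have := fs i; rewrite setTI. Qed.

Lemma near_coord_inv (R : realType) (n : nat) (M : manifold R n) i (x : M)
    (P : set M) : dom M i x -> nbhs x P ->
  \forall y \near coord M i x, P (coord_inv M i y).
Proof.
move=> ix Px; have /= := @coord_inv_continuous R n M i (coord M i x).
by apply; [exists x|rewrite coordK].
Qed.

Lemma nbhs_dom (R : realType) (n : nat) (M : manifold R n) i (x : M) :
  dom M i x -> nbhs x (dom M i).
Proof. by move=> ix; exact: open_nbhs_nbhs (conj (dom_open i) ix). Qed.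

Lemma open_image_coord (R : realType) (n : nat) (M : manifold R n) i
    (U : set M) : open U -> open (coord M i @` (U `&` dom M i)).
Proof.
move=> Uo; rewrite openE => _ [x [Ux ix] <-].
have xU := near_coord_inv ix (open_nbhs_nbhs (conj Uo Ux)).
have xi : nbhs (coord M i x) (coord M i @` dom M i).
  by apply: open_nbhs_nbhs; split; [exact: image_open|exists x].
apply: filterS2 xU xi => y /= + [z iz zy]; rewrite -zy coordK // => Uz.
by exists z.
Qed.

(** Every point lies either in [U], where F is smooth, or in the open
complement of [C], where F vanishes. *)
Lemma smooth_on_patch (R : realType) (n : nat) (M : manifold R n)
    (W : normedModType R) i (U C : set M) (F : M -> W) :
  closed C -> C `<=` U -> (forall x, ~ C x -> F x = 0) ->
  smooth_on (coord M i @` (U `&` dom M i)) (F \o coord_inv M i) ->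
  smooth_on (coord M i @` (setT `&` dom M i)) (F \o coord_inv M i).
Proof.
move=> Cc CU F0 Fs k; apply: class_C_pointwise => _ [x [_ ix] <-].
have [Cx|nCx] := pselect (C x).
  by apply: sub_class_C (Fs k) => _ ->; exists x; split=> //; exact: CU.
apply: near_eq_class_C (class_C_cst k _ 0) => _ ->.
have nC : nbhs x (~` C).
  by apply: open_nbhs_nbhs; split => //; exact: closed_openC.
by apply: filterS (near_coord_inv ix nC) => y /F0.
Qed.

Lemma smooth_on_change_chart (R : realType) (n : nat) (M : manifold R n)
    (W : normedModType R) (U : set M) i j (f : 'rV[R]_n -> W) : open U ->
  smooth_on (coord M i @` (U `&` dom M i)) f ->
  smooth_on (coord M j @` (U `&` dom M i `&` dom M j))
    (f \o (coord M i \o coord_inv M j)).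
Proof.
move=> Uo fs k.
have Ao : open (coord M j @` (U `&` dom M i `&` dom M j)).
  by apply: open_image_coord; apply: openI => //; exact: dom_open.
apply: class_C_comp (fs k) _ => //.
  by move=> _ [x [[Ux ix] jx] <-] /=; rewrite coordK //; exists x.
apply: sub_class_C (transition_smooth j i k) => _ [x [[_ ix] jx] <-].
by exists x.
Qed.

Lemma smooth_function_on_chart (R : realType) (n : nat) (M : manifold R n)
    i (f : 'rV[R]_n -> R) (g : M -> R) :
  smooth_on (coord M i @` dom M i) f ->
  (forall x, dom M i x -> g x = f (coord M i x)) ->
  smooth_function_on (dom M i) g.
Proof.
move=> fs gE j k; have := smooth_on_change_chart j openT (i := i) (f := f).
rewrite !setTI => /(_ fs k); apply: eq_class_C.
  by apply: open_image_coord; exact: dom_open.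
by move=> _ [x [ix jx] <-] /=; rewrite coordK // gE.
Qed.

Lemma smooth_function_on_continuous (R : realType) (n : nat) (M : manifold R n)
    (U : set M) (f : M -> R) x : smooth_function_on U f -> U x ->
  {for x, continuous f}.
Proof.
move=> fs Ux; have [i ix] := dom_cover x.
have fc : {for coord M i x, continuous (f \o coord_inv M i)}.
  by apply: (fs i 0%N); exists x.
have : ((f \o coord_inv M i) \o coord M i) z @[z --> x] --> f x.
  rewrite -[in f x](coordK ix).
  exact: continuous_comp (Defs.coord_continuous ix) fc.
apply: cvg_trans; apply: near_eq_cvg.
by apply: filterS (nbhs_dom ix) => z iz /=; rewrite coordK.
Qed.

(** The bump vanishes off the image of a closed ball, which is compact, hence
closed in M because M is Hausdorff; without that property the extension by 0
could fail to be smooth. *)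
Lemma smooth_bump (R : realType) (n : nat) (M : manifold R n) i (x : M)
    (U : set M) : open U -> U x -> U `<=` dom M i ->
  exists (phi : M -> R) (C : set M),
    [/\ smooth_function phi, closed C, C `<=` U,
        forall z, ~ C z -> phi z = 0 & \forall z \near x, phi z = 1].
Proof.
move=> Uo Ux Ui; have ix := Ui _ Ux.
have : nbhs (coord M i x) (coord M i @` (U `&` dom M i)).
  by apply: open_nbhs_nbhs; split; [exact: open_image_coord|exists x].
move=> /nbhs_closedballP[r rU].
have [b [bs b1 b0]] := smooth_bump_row (coord M i x) (gt0 r).
pose K := closed_ball (coord M i x) r%:num.
have KE : K = [set y | `|y - coord M i x| <= r%:num].
  rewrite /K closed_ballE //; apply/funext => y.
  by rewrite /closed_ball_ /= distrC.
have KU : K `<=` coord M i @` (U `&` dom M i) by exact: rU.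
have Kc : compact K.
  apply: bounded_closed_compact; last exact: closed_ball_closed.
  exists (r%:num + `|coord M i x|); split; first exact: num_real.
  move=> m rm y; rewrite KE /= => yr; apply: le_trans (ltW rm).
  by rewrite -[y](subrK (coord M i x)) (le_trans (ler_normD _ _)) // lerD2r.
pose C := coord_inv M i @` K.
have Cc : closed C.
  apply: compact_closed; first exact: carrier_hausdorff.
  apply: continuous_compact Kc; apply: continuous_in_subspaceT => y.
  rewrite inE => /KU[z [_ iz] <-].
  by apply: coord_inv_continuous; exists z.
have CU : C `<=` U.
  by move=> _ [y /KU[z [Uz iz] <-] <-]; rewrite coordK.
pose phi z := if `[< dom M i z >] then b (coord M i z) else 0.
have phi0 z : ~ C z -> phi z = 0.
  rewrite /phi; case: asboolP => // iz nCz; apply: b0; rewrite ltNge.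
  by apply/negP => Kz; apply: nCz; exists (coord M i z); rewrite ?coordK // KE.
exists phi, C; split => //.
  apply/smooth_function_onT => j.
  apply: (smooth_on_patch (U := dom M i)) Cc _ _ _ => //.
    exact: subset_trans Ui.
  apply: (smooth_function_on_chart (f := b)) => [k|z iz].
    exact: sub_class_C (bs k).
  by rewrite /phi asboolT.
have := @Defs.coord_continuous R n M i x ix _ b1.
by apply: filterS2 (nbhs_dom ix) => z iz; rewrite /phi asboolT.
Qed.

(** * Tangent vectors and coordinate vector fields *)

Lemma transition_differentiable (R : realType) (n : nat) (M : manifold R n)
    i j (x : M) : dom M i x -> dom M j x ->
  differentiable (coord M j \o coord_inv M i) (coord M i x).
Proof.
move=> ix jx; have [+ _] := transition_smooth i j 1%N.
by apply; exists x.
Qed.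

Lemma tangent_linear (R : realType) (n : nat) (M : manifold R n) (x : M) a v w :
  tangent x v -> tangent x w -> tangent x (a *: v + w).
Proof.
move=> [v0 vT] [w0 wT]; split=> [i nix|i j ix jx].
  by rewrite !fctE v0 // w0 // scaler0 addr0.
have dT := transition_differentiable ix jx.
rewrite !fctE (vT i j) // (wT i j) // !deriveE //.
by rewrite linearP.
Qed.

Lemma tangent0 (R : realType) (n : nat) (M : manifold R n) (x : M) :
  tangent x 0.
Proof. by split=> // i j _ _; rewrite derive0. Qed.

Lemma tangent_sum (R : realType) (n : nat) (M : manifold R n) (x : M) m
    (a : 'I_m -> R) (v : 'I_m -> chart M -> 'rV[R]_n) :
  (forall k, tangent x (v k)) -> tangent x (\sum_k a k *: v k).
Proof.
move=> vT; elim/big_ind: _ => [|u w uT wT|k _]; first exact: tangent0.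
  by rewrite -[u]scale1r; exact: tangent_linear.
by rewrite -[_ *: _]addr0; apply: tangent_linear => //; exact: tangent0.
Qed.

(** The other components are determined by the one in the chart i through the
Jacobians. *)
Lemma tangent_eq (R : realType) (n : nat) (M : manifold R n) i (x : M) v w :
  dom M i x -> tangent x v -> tangent x w -> v i = w i -> v = w.
Proof.
move=> ix [v0 vT] [w0 wT] vw; apply/funext => j.
have [jx|njx] := pselect (dom M j x); last by rewrite v0 // w0.
by rewrite (vT i j) // (wT i j) // vw.
Qed.

(** The vector field on the domain of the chart i with constant components w
in it; its component in the chart j is the Jacobian of the transition map
applied to w. *)
Definition coord_field (R : realType) (n : nat) (M : manifold R n) (i : chart M)
    (w : 'rV[R]_n) : field M := fun x j =>
  if `[< dom M i x /\ dom M j x >]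
  then 'D_w (coord M j \o coord_inv M i) (coord M i x) else 0.

Lemma coord_field_self (R : realType) (n : nat) (M : manifold R n) i w (x : M) :
  dom M i x -> coord_field i w x i = w.
Proof.
move=> ix; rewrite /coord_field asboolT //.
rewrite -[RHS](@derive_id R 'rV[R]_n (coord M i x)); apply: near_eq_derive.
have xi : nbhs (coord M i x) (coord M i @` dom M i).
  by apply: open_nbhs_nbhs; split; [exact: image_open|exists x].
by apply: filterS xi => _ [z iz <-] /=; rewrite coordK.
Qed.

(** The cocycle condition on the components is the chain rule for the
composition of two transition maps. *)
Lemma coord_field_tangent (R : realType) (n : nat) (M : manifold R n) i w
    (x : M) : dom M i x -> tangent x (coord_field i w x).
Proof.
move=> ix; split=> [j njx|j k jx kx]; rewrite /coord_field.
  by rewrite asboolF // => -[].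
rewrite !asboolT //.
have cx : (coord M j \o coord_inv M i) (coord M i x) = coord M j x.
  by rewrite /= coordK.
rewrite -cx -derive_comp ?cx; [|exact: transition_differentiable..].
apply: near_eq_derive.
by apply: filterS (near_coord_inv ix (nbhs_dom jx)) => y jy /=; rewrite coordK.
Qed.

(** In the chart j the field is the derivative along w of the transition map
from i to j, composed with the transition map from j to i. *)
Lemma coord_field_vector_field (R : realType) (n : nat) (M : manifold R n) i w :
  vector_field (dom M i) (@coord_field R n M i w).
Proof.
split=> [x ix|j k]; first exact: coord_field_tangent.
have /= [_ Dk] := transition_smooth i j k.+1.
have Ao : open (coord M j @` (dom M i `&` dom M j)).
  by apply: open_image_coord; exact: dom_open.
have : class_C k (coord M j @` (dom M i `&` dom M j))
    ('D_w (coord M j \o coord_inv M i) \o (coord M i \o coord_inv M j)).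
  apply: class_C_comp Ao _ (Dk w) _.
    by move=> _ [x [ix jx] <-] /=; rewrite coordK //; exists x.
  by rewrite setIC; exact: transition_smooth.
apply: eq_class_C => // _ [x [ix jx] <-].
by rewrite /= /coord_field coordK // asboolT.
Qed.

(** * Operations on vector fields *)

Lemma sub_vector_field (R : realType) (n : nat) (M : manifold R n)
    (U V : set M) (X : field M) :
  U `<=` V -> vector_field V X -> vector_field U X.
Proof.
move=> UV [XT Xs]; split=> [x /UV|i k]; first exact: XT.
apply: sub_class_C (Xs i k) => _ [x [Ux ix] <-].
by exists x; split=> //; exact: UV.
Qed.

Lemma sub_smooth_function_on (R : realType) (n : nat) (M : manifold R n)
    (U V : set M) (f : M -> R) :
  U `<=` V -> smooth_function_on V f -> smooth_function_on U f.
Proof.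
move=> UV fs i k.
apply: sub_class_C (fs i k) => _ [x [Ux ix] <-].
by exists x; split=> //; exact: UV.
Qed.

Lemma vector_field_scale (R : realType) (n : nat) (M : manifold R n)
    (U : set M) (f : M -> R) (X : field M) : open U ->
  smooth_function_on U f -> vector_field U X -> vector_field U (fscale f X).
Proof.
move=> Uo fs [XT Xs]; split=> [x Ux|i k].
  rewrite /fscale -[_ *: _]addr0;
  by apply: tangent_linear; [exact: XT|exact: tangent0].
by apply: class_C_scale (fs i k) (Xs i k); exact: open_image_coord.
Qed.

Lemma vector_fieldD (R : realType) (n : nat) (M : manifold R n)
    (U : set M) (X Y : field M) : open U ->
  vector_field U X -> vector_field U Y -> vector_field U (X \+ Y).
Proof.
move=> Uo [XT Xs] [YT Ys]; split=> [x Ux|i k].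
  by rewrite /= -[X x]scale1r; apply: tangent_linear; [exact: XT|exact: YT].
by apply: class_CD (Xs i k) (Ys i k); exact: open_image_coord.
Qed.

Lemma vector_field0 (R : realType) (n : nat) (M : manifold R n) (U : set M) :
  vector_field U (fun=> 0 : chart M -> 'rV[R]_n).
Proof. by split=> [x _|i k]; [exact: tangent0|exact: class_C_cst]. Qed.

Lemma vector_field_sum (R : realType) (n : nat) (M : manifold R n)
    (U : set M) m (f : 'I_m -> M -> R) (X : 'I_m -> field M) : open U ->
  (forall k, smooth_function_on U (f k)) -> (forall k, vector_field U (X k)) ->
  vector_field U (fun x => \sum_k f k x *: X k x).
Proof.
move=> Uo; elim: m f X => [|m IH] f X fs Xs.
  by under eq_fun do rewrite big_ord0; exact: vector_field0.
under eq_fun do rewrite big_ord_recl.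
apply: (vector_fieldD (X := fscale (f ord0) (X ord0))) => //.
  exact: vector_field_scale.
exact: IH.
Qed.

Lemma vector_field_extend (R : realType) (n : nat) (M : manifold R n)
    (U C : set M) (phi : M -> R) (X : field M) : open U ->
  smooth_function phi -> closed C -> C `<=` U ->
  (forall x, ~ C x -> phi x = 0) -> vector_field U X ->
  vector_field setT (fscale phi X).
Proof.
move=> Uo phis Cc CU phi0 XU; have phiU : smooth_function_on U phi.
  by apply: (sub_smooth_function_on (V := setT)) => //; exact/smooth_function_onT.
have [XT Xs] := vector_field_scale Uo phiU XU; split=> [x _|i].
  have [Cx|nCx] := pselect (C x); first exact/XT/CU.
  by rewrite /fscale phi0 // scale0r; exact: tangent0.
apply: (smooth_on_patch (F := fun x => fscale phi X x i)) Cc CU _ (Xs i).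
move=> x nCx.
by rewrite /fscale phi0 // scale0r.
Qed.

Lemma smooth_function_extend (R : realType) (n : nat) (M : manifold R n)
    (U C : set M) (phi f : M -> R) : open U ->
  smooth_function phi -> closed C -> C `<=` U ->
  (forall x, ~ C x -> phi x = 0) -> smooth_function_on U f ->
  smooth_function (fun x => phi x * f x).
Proof.
move=> Uo phis Cc CU phi0 fU; apply/smooth_function_onT => i.
apply: (smooth_on_patch Cc CU) => [x nCx|k]; first by rewrite phi0 // mul0r.
apply: class_C_scale (fU i k); first exact: open_image_coord.
apply: sub_class_C (phis i k) => _ [x [_ ix] <-]; by exists x.
Qed.

Lemma smooth_functionM (R : realType) (n : nat) (M : manifold R n)
    (f g : M -> R) : smooth_function f -> smooth_function g ->
  smooth_function (fun x => f x * g x).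
Proof.
move=> fs gs i k.
by apply: class_C_scale (fs i k) (gs i k); exact: image_open.
Qed.

Lemma smooth_functionD (R : realType) (n : nat) (M : manifold R n)
    (f g : M -> R) : smooth_function f -> smooth_function g ->
  smooth_function (fun x => f x + g x).
Proof.
move=> fs gs i k.
by apply: class_CD (fs i k) (gs i k); exact: image_open.
Qed.

Lemma smooth_function_cst (R : realType) (n : nat) (M : manifold R n) (c : R) :
  smooth_function (cst c : M -> R).
Proof. move=> i k; exact: class_C_cst. Qed.

(** The coefficient is smooth in the chart i by definition of a vector field,
and hence in all charts. *)
Lemma vector_field_coefficient (R : realType) (n : nat) (M : manifold R n)
    (X : field M) i k : vector_field (dom M i) X ->
  smooth_function_on (dom M i) (fun x => X x i ord0 k).
Proof.
move=> [_ Xs]; have := Xs i; rewrite setIid => Xi.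
apply: (smooth_function_on_chart (i := i)
    (f := fun y => X (coord_inv M i y) i ord0 k)).
  move=> m; apply: class_C_coordinate; [exact: image_open|exact: Xi].
by move=> x ix; rewrite coordK.
Qed.

(** * Locality of a linear connection *)

Lemma vector_fieldT_scale (R : realType) (n : nat) (M : manifold R n)
    (f : M -> R) (X : field M) : smooth_function f ->
  vector_field setT X -> vector_field setT (fscale f X).
Proof.
by move=> fs; apply: vector_field_scale openT _; exact/smooth_function_onT.
Qed.

Lemma vector_fieldT_sum (R : realType) (n : nat) (M : manifold R n) m
    (f : 'I_m -> M -> R) (X : 'I_m -> field M) :
  (forall k, smooth_function (f k)) -> (forall k, vector_field setT (X k)) ->
  vector_field setT (fun x => \sum_k f k x *: X k x).
Proof.
by move=> fs; apply: vector_field_sum openT _ => k; exact/smooth_function_onT.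
Qed.

Lemma nabla0l (R : realType) (n : nat) (M : manifold R n)
    (nabla : field M -> field M -> field M) (Y : field M) :
  linear_connection nabla -> vector_field setT Y ->
  nabla (fun=> 0) Y = fun=> 0.
Proof.
move=> nablaP Yv.
have := nablaZl nablaP (@smooth_function_cst R n M 0) Yv Yv.
have f0 Z : fscale (cst 0 : M -> R) Z = fun=> 0.
  by apply/funext => x; rewrite /fscale scale0r.
by rewrite !f0.
Qed.

Lemma nabla0r (R : realType) (n : nat) (M : manifold R n)
    (nabla : field M -> field M -> field M) (X : field M) :
  linear_connection nabla -> vector_field setT X ->
  nabla X (fun=> 0) = fun=> 0.
Proof.
move=> nablaP Xv.
pose Z : field M := fun=> 0; have Zv : vector_field setT Z by exact: vector_field0.
have ZZ : Z \+ Z = Z by apply/funext => x; rewrite /= addr0.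
have := nablaDr nablaP Xv Zv Zv; rewrite ZZ => nE; apply/funext => x.
by apply: (addrI (nabla X Z x)); rewrite addr0 [in RHS]nE.
Qed.

Lemma nabla_suml (R : realType) (n : nat) (M : manifold R n)
    (nabla : field M -> field M -> field M) m
    (f : 'I_m -> M -> R) (X : 'I_m -> field M) (Y : field M) x :
  linear_connection nabla ->
  (forall k, smooth_function (f k)) -> (forall k, vector_field setT (X k)) ->
  vector_field setT Y ->
  nabla (fun x => \sum_k f k x *: X k x) Y x =
    \sum_k f k x *: nabla (X k) Y x.
Proof.
move=> nablaP; elim: m f X => [|m IH] f X fs Xv Yv.
  by under eq_fun do rewrite big_ord0; rewrite nabla0l // big_ord0.
under eq_fun do rewrite big_ord_recl.
rewrite (nablaDl nablaP (X := fscale (f ord0) (X ord0))) //.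
- by rewrite /= nablaZl // IH // big_ord_recl.
- exact: vector_fieldT_scale.
- exact: vector_fieldT_sum.
Qed.

Lemma nabla_sumr (R : realType) (n : nat) (M : manifold R n)
    (nabla : field M -> field M -> field M) m
    (f : 'I_m -> M -> R) (X : field M) (Y : 'I_m -> field M) x :
  linear_connection nabla ->
  (forall k, smooth_function (f k)) -> vector_field setT X ->
  (forall k, vector_field setT (Y k)) ->
  nabla X (fun x => \sum_k f k x *: Y k x) x =
    \sum_k (lie X (f k) x *: Y k x + f k x *: nabla X (Y k) x).
Proof.
move=> nablaP; elim: m f Y => [|m IH] f Y fs Xv Yv.
  by under eq_fun do rewrite big_ord0; rewrite nabla0r // big_ord0.
under eq_fun do rewrite big_ord_recl.
rewrite (nablaDr nablaP (Y := fscale (f ord0) (Y ord0))) //.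
- by rewrite /= nabla_leibniz // IH // big_ord_recl.
- exact: vector_fieldT_scale.
- exact: vector_fieldT_sum.
Qed.

(** In a chart X is a combination of the coordinate fields whose coefficients
vanish at x; after multiplication by bump functions the combination is one of
global fields and functions, to which linearity over the smooth functions
applies. *)
Lemma nabla_eq0 (R : realType) (n : nat) (M : manifold R n)
    (nabla : field M -> field M -> field M) (X Y : field M) x :
  linear_connection nabla -> vector_field setT X -> vector_field setT Y ->
  X x = 0 -> nabla X Y x = 0.
Proof.
move=> nablaP Xv Yv Xx0; have [i ix] := dom_cover x.
have io := dom_open i.
have [phi [C [phis Cc CU phi0 phi1]]] := smooth_bump io ix (@subset_refl _ _).
have phix : phi x = 1 by exact: nbhs_singleton phi1.
pose E k := fscale phi (coord_field i (delta_mx ord0 k)).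
pose f k z := phi z * X z i ord0 k.
have Ev k : vector_field setT (E k).
  exact: vector_field_extend phis Cc CU phi0 (@coord_field_vector_field _ _ _ _ _).
have Xi : vector_field (dom M i) X by apply: sub_vector_field Xv.
have fs k : smooth_function (f k).
  exact: smooth_function_extend phis Cc CU phi0 (vector_field_coefficient k Xi).
(* One factor phi globalises the coefficient, the other one the coordinate
   field. *)
have XE : fscale (fun z => phi z * phi z) X = (fun z => \sum_k f k z *: E k z).
  apply/funext => z; rewrite /fscale.
  have [Cz|nCz] := pselect (C z); last first.
    rewrite phi0 // mulr0 scale0r big1 // => k _.
    by rewrite /f phi0 // mul0r scale0r.
  have iz := CU _ Cz; apply: (tangent_eq iz).
  - rewrite -[_ *: _]addr0.
    by apply: tangent_linear; [exact: Xv.1|exact: tangent0].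
  - by apply: tangent_sum => k; exact: (Ev k).1.
  rewrite fctE fct_sumE {1}(row_sum_delta (X z i)) scaler_sumr.
  apply: eq_bigr => k _.
  rewrite /f /E /fscale !fctE coord_field_self // !scalerA; congr (_ *: _).
  by rewrite mulrAC.
have := nablaZl nablaP (smooth_functionM phis phis) Xv Yv.
move=> /(congr1 (@^~ x)); rewrite XE nabla_suml //.
rewrite /fscale phix mulr1 scale1r => <-.
by rewrite big1 // => k _; rewrite /f Xx0 mxE mulr0 scale0r.
Qed.

Lemma nabla_pointwise (R : realType) (n : nat) (M : manifold R n)
    (nabla : field M -> field M -> field M) (X X' Y : field M) x :
  linear_connection nabla -> vector_field setT X -> vector_field setT X' ->
  vector_field setT Y -> X x = X' x -> nabla X Y x = nabla X' Y x.
Proof.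
move=> nablaP Xv X'v Yv XX'.
have cs := @smooth_function_cst R n M (-1).
have NX'v := vector_fieldT_scale cs X'v.
have scaleN (Z : chart M -> 'rV[R]_n) : (cst (-1) : M -> R) x *: Z = - Z.
  by rewrite /cst scaleN1r.
have H := nabla_eq0 (x := x) nablaP (vector_fieldD openT Xv NX'v) Yv.
have {H} : nabla X Y x - nabla X' Y x = 0.
  rewrite -[RHS]H; first by rewrite nablaDl // nablaZl //= /fscale scaleN.
  by rewrite /= /fscale scaleN XX' subrr.
by move/eqP; rewrite subr_eq0 => /eqP.
Qed.

(** With a bump function phi around x supported where Y = Y', the fields phi Y
and phi Y' are equal; in the Leibniz rule at x the terms with the derivative
of phi agree, since Y x = Y' x. *)
Lemma nabla_local (R : realType) (n : nat) (M : manifold R n)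
    (nabla : field M -> field M -> field M) (X Y Y' : field M) x :
  linear_connection nabla -> vector_field setT X -> vector_field setT Y ->
  vector_field setT Y' -> (\forall y \near x, Y y = Y' y) ->
  nabla X Y x = nabla X Y' x.
Proof.
move=> nablaP Xv Yv Y'v YY'; have [i ix] := dom_cover x.
pose U := [set z | Y z = Y' z]^° `&` dom M i.
have Uo : open U by apply: openI; [exact: open_interior|exact: dom_open].
have Ux : U x by split.
have [phi [C [phis Cc CU phi0 phi1]]] := smooth_bump Uo Ux (@subIsetr _ _ _).
have phiE : fscale phi Y = fscale phi Y'.
  apply/funext => z; rewrite /fscale; have [Cz|nCz] := pselect (C z).
    by have [/interior_subset /= -> _] := CU _ Cz.
  by rewrite phi0 // !scale0r.
have := nabla_leibniz nablaP phis Xv Yv.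
rewrite phiE (nabla_leibniz nablaP phis Xv Y'v) => /(congr1 (@^~ x)) /=.
rewrite /fscale (nbhs_singleton phi1) (nbhs_singleton YY') !scale1r.
by move=> /addrI.
Qed.

(** * Frames with vanishing connection components *)

Lemma det_continuous (R : realType) (T : topologicalType) n
    (A : T -> 'M[R]_n) x :
  (forall j k, {for x, continuous (fun z => A z j k)}) ->
  {for x, continuous (fun z => \det (A z))}.
Proof.
move=> Ac; rewrite /determinant.
apply: cvg_big => [|s _]; first exact: add_continuous.
apply: cvgM; first exact: cvg_cst.
by apply: cvg_big => [|j _]; [exact: mul_continuous|exact: Ac].
Qed.

Definition frame_mx (R : realType) (n : nat) (M : manifold R n) (i : chart M)
    (E : 'I_n -> field M) (x : M) : 'M[R]_n := \matrix_(j < n) E j x i.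

Lemma frame_mx_sum (R : realType) (n : nat) (M : manifold R n) (i : chart M)
    (E : 'I_n -> field M) (x : M) (c : 'I_n -> R) :
  (\sum_j c j *: E j x) i = (\row_j c j) *m frame_mx i E x.
Proof.
rewrite fct_sumE mulmx_sum_row; apply: eq_bigr => j _.
by rewrite mxE rowK.
Qed.

(** Both sides are tangent vectors, so comparing their components in the chart
i is enough. *)
Lemma frame_mx_decomposition (R : realType) (n : nat) (M : manifold R n)
    (i : chart M) (E : 'I_n -> field M) (x : M) v : dom M i x ->
  (forall j, tangent x (E j x)) -> frame_mx i E x \in unitmx -> tangent x v ->
  v = \sum_j (v i *m invmx (frame_mx i E x)) ord0 j *: E j x.
Proof.
move=> ix ET Eu vT; apply: (tangent_eq ix) => //; first exact: tangent_sum.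
rewrite frame_mx_sum (_ : \row_j _ = v i *m invmx (frame_mx i E x)).
  by rewrite mulmxKV.
by apply/rowP => j; rewrite mxE.
Qed.

Lemma frame_mx_local_frame (R : realType) (n : nat) (M : manifold R n)
    (i : chart M) (E : 'I_n -> field M) (U : set M) : U `<=` dom M i ->
  (forall j, vector_field U (E j)) ->
  (forall x, U x -> frame_mx i E x \in unitmx) -> local_frame U E.
Proof.
move=> Ui EU Eu; split=> // x Ux; split=> [c c0 j|v vT].
  have /(congr1 (@^~ i)) := c0; rewrite frame_mx_sum => c0i.
  have : \row_j c j = 0.
    by rewrite -[\row_j _](mulmxK (Eu x Ux)) c0i mul0mx.
  by move=> /rowP/(_ j); rewrite !mxE.
exists (fun j => (v i *m invmx (frame_mx i E x)) ord0 j).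
apply: frame_mx_decomposition => //; [exact: Ui| |exact: Eu].
by move=> j; exact: (EU j).1.
Qed.

(** Global extensions of X and E_j can be replaced by a combination of the E_k
with constant coefficients [a k x] and by E_j itself, thanks to the locality
of nabla; the components are then those of nabla_(E_k) E_j in the basis E at
each point. *)
Lemma frame_mx_components (R : realType) (n : nat) (M : manifold R n)
    (nabla : field M -> field M -> field M) (i : chart M)
    (E : 'I_n -> field M) (U : set M) : linear_connection nabla ->
  open U -> U `<=` dom M i -> (forall j, vector_field setT (E j)) ->
  (forall x, U x -> frame_mx i E x \in unitmx) ->
  connection_components nabla U E (fun l j k x =>
    (nabla (E k) (E j) x i *m invmx (frame_mx i E x)) ord0 l).
Proof.
move=> nablaP Uo Ui Ev Eu X a XU XE j x Ux; split.
  have [phi [C [phis Cc CU phi0 phi1]]] := smooth_bump Uo Ux Ui.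
  exists (fscale phi X), (E j); split; split => //.
  - exact: vector_field_extend phis Cc CU phi0 XU.
  - by apply: filterS phi1 => z phiz; rewrite /fscale phiz scale1r.
  - exact: nearW.
move=> X' Y' [X'v X'X] [Y'v Y'E].
rewrite (nabla_local nablaP X'v Y'v (Ev j) Y'E).
pose X2 z := \sum_k a k x *: E k z.
have X'x : X' x = X2 x by rewrite (nbhs_singleton X'X) XE.
have cst_smooth k : smooth_function (cst (a k x) : M -> R).
  exact: smooth_function_cst.
have X2v : vector_field setT X2.
  exact: (vector_fieldT_sum cst_smooth Ev).
rewrite (nabla_pointwise nablaP X'v X2v (Ev j) X'x).
rewrite (nabla_suml x nablaP cst_smooth Ev (Ev j)).
rewrite [RHS]exchange_big /=; apply: eq_bigr => k _.
rewrite {1}(@frame_mx_decomposition R n M i E x (nabla (E k) (E j) x)).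
- by rewrite scaler_sumr; apply: eq_bigr => l _; rewrite scalerA mulrC.
- exact: Ui.
- by move=> l; exact: (Ev l).1.
- exact: Eu.
- exact: (nabla_field nablaP (Ev k) (Ev j)).1.
Qed.

Theorem corollary13 (R : realType) (n : nat) (M : manifold R n)
    (nabla : field M -> field M -> field M)
    (nablaP : linear_connection nabla) (x0 : M) :
  exists (U : set M) (E : 'I_n -> field M)
         (Gamma : 'I_n -> 'I_n -> 'I_n -> M -> R),
    [/\ open U, U x0, local_frame U E,
        connection_components nabla U E Gamma
      & forall i j k, Gamma i j k x0 = 0].
Proof.
(* [lie] at x0 is computed in this very chart. *)
pose i := chart_at x0.
have ix0 : dom M i x0 by exact: projT2 (cid (dom_cover x0)).
have io := dom_open i; pose y0 := coord M i x0.
have [phi [C [phis Cc CU phi0 phi1]]] := smooth_bump io ix0 (@subset_refl _ _).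
have phix0 : phi x0 = 1 by exact: nbhs_singleton phi1.
pose D (k : 'I_n) := fscale phi (coord_field i (delta_mx ord0 k)).
have Dv k : vector_field setT (D k).
  exact: vector_field_extend phis Cc CU phi0 (@coord_field_vector_field _ _ _ _ _).
have Dx0 k : D k x0 i = delta_mx ord0 k.
  by rewrite /D /fscale phix0 scale1r coord_field_self.
pose gamma (k j m : 'I_n) : R := nabla (D k) (D j) x0 i ord0 m.
have gammaE k j : nabla (D k) (D j) x0 = \sum_m gamma k j m *: D m x0.
  apply: (tangent_eq ix0).
  - exact: (nabla_field nablaP (Dv k) (Dv j)).1.
  - by apply: tangent_sum => m; exact: (Dv m).1.
  rewrite fct_sumE [LHS]row_sum_delta.
  by apply: eq_bigr => m _; rewrite !fctE Dx0.
pose L (j m : 'I_n) (y : 'rV[R]_n) : R :=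
  \sum_l (- gamma l j m) *: (y - y0) ord0 l.
(* phi makes B global without changing its germ at x0. *)
pose B (j m : 'I_n) z := (j == m)%:R + phi z * L j m (coord M i z).
have Lx0 j m : L j m y0 = 0.
  by rewrite /L big1 // => l _; rewrite subrr mxE scaler0.
have Bx0 j m : B j m x0 = (j == m)%:R by rewrite /B Lx0 mulr0 addr0.
have Bs j m : smooth_function (B j m).
  apply: smooth_functionD; first exact: smooth_function_cst.
  apply: smooth_function_extend phis Cc CU phi0 _ => //.
  apply: (smooth_function_on_chart (i := i) (f := L j m)) => // k.
  have Io := @image_open R n M i.
  apply: class_C_sum => // l; apply: class_C_scale => //; first exact: class_C_cst.
  apply: class_C_coordinate => //.
  apply: class_CD => //; last exact: class_C_cst.
  by apply: (@class_C_linear _ _ _ _ _ idfun) => y; exact: cvg_id.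
have lieB k j m : lie (D k) (B j m) x0 = - gamma k j m.
  rewrite /lie -/i Dx0.
  transitivity ('D_(delta_mx ord0 k) (fun y => (j == m)%:R + L j m y) y0).
    apply: near_eq_derive.
    have yi : nbhs y0 (coord M i @` dom M i).
      by apply: open_nbhs_nbhs; split; [exact: image_open|exists x0].
    apply: filterS2 yi (near_coord_inv ix0 phi1) => _ [z iz <-] /=.
    by rewrite coordK // /B => ->; rewrite mul1r.
  apply: derive_affine => h; rewrite Lx0 addr0; congr (_ + _).
  rewrite /L addrK (bigD1 k) //= big1 => [|l lk].
    by rewrite !mxE !eqxx mulr1 addr0 /GRing.scale /= mulrC.
  by rewrite !mxE (negbTE lk) andbF mulr0 scaler0.
pose E (j : 'I_n) : field M := fun z => \sum_m B j m z *: D m z.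
have Ev j : vector_field setT (E j) by exact: vector_fieldT_sum.
have Ex0 j : E j x0 = D j x0.
  rewrite /E (bigD1 j) //= Bx0 eqxx scale1r big1 ?addr0 // => m mj.
  by rewrite Bx0 eq_sym (negbTE mj) scale0r.
pose U := [set z | dom M i z /\ frame_mx i E z \in unitmx]^°.
have Usub z : U z -> dom M i z /\ frame_mx i E z \in unitmx.
  by move=> /interior_subset.
have Ux0 : U x0.
  have detc : {for x0, continuous (fun z => \det (frame_mx i E z))}.
    apply: det_continuous => j k.
    have -> : (fun z => frame_mx i E z j k) = (fun z => E j z i ord0 k).
      by apply/funext => z; rewrite mxE.
    have EU : vector_field (dom M i) (E j) by apply: sub_vector_field (Ev j).
    exact: smooth_function_on_continuous (vector_field_coefficient k EU) ix0.
  have detx0 : \det (frame_mx i E x0) = 1.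
    rewrite (_ : frame_mx i E x0 = 1%:M) ?det1 //.
    by apply/row_matrixP => j; rewrite rowK Ex0 Dx0 row1.
  have det0 : \forall z \near x0, \det (frame_mx i E z) != 0.
    by apply: (cvgr_neq0 _ detc); rewrite detx0 oner_neq0.
  apply: filterS2 (nbhs_dom ix0) det0 => z iz dz; split => //.
  by rewrite unitmxE unitfE.
have Uo : open U by exact: open_interior.
have Ui : U `<=` dom M i by move=> z /Usub[].
have Eu z : U z -> frame_mx i E z \in unitmx by move=> /Usub[].
exists U, E; eexists; split; [exact: Uo|exact: Ux0| | |].
- by apply: frame_mx_local_frame Ui _ Eu => j; apply: sub_vector_field (Ev j).
- exact: frame_mx_components nablaP Uo Ui Ev Eu.
move=> l j k /=.
have -> : nabla (E k) (E j) x0 = 0.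
  rewrite (nabla_pointwise nablaP (Ev k) (Dv k) (Ev j) (Ex0 k)).
  rewrite (nabla_sumr x0 nablaP (Bs j) (Dv k) Dv) big_split /=.
  have -> : \sum_m B j m x0 *: nabla (D k) (D m) x0 = nabla (D k) (D j) x0.
    rewrite (bigD1 j) //= Bx0 eqxx scale1r big1 ?addr0 // => m mj.
    by rewrite Bx0 eq_sym (negbTE mj) scale0r.
  rewrite gammaE -big_split big1 //= => m _.
  by rewrite lieB scaleNr addNr.
by rewrite mul0mx mxE.
Qed.
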